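(* Let $H$ be a graph. Then $\#\mathrm{Hom}(H)\le\#\mathrm{SHom}(H)$.
   Context: Graphs are finite, undirected, possibly with loops; irreflexive means no loops. A homomorphism $h:V(G)\to V(H)$ maps each edge of $G$ to an edge of $H$; it is surjective if every vertex of $H$ is an image. $\#\mathrm{Hom}(H)$: given an irreflexive graph $G$, output the number of homomorphisms from $G$ to $H$. $\#\mathrm{SHom}(H)$: given an irreflexive graph $G$, output the number of surjective homomorphisms from $G$ to $H$. $P_1\le P_2$ denotes a polynomial-time Turing reduction. *)

(* Defs.v *)
From HB Require Import structures.
From mathcomp Require Import all_boot all_order all_algebra.

Set Implicit Arguments.
Unset Strict Implicit.
Unset Printing Implicit Defensive.

Record graph := Graph {
  vertex :> finType;
  edge : rel vertex;
  edge_sym : symmetric edge }.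

(* Problem instances carry the vertex set {0, ..., n - 1}, which fixes the
   row order of their adjacency matrix. *)
Record irrefl_graph := IrreflGraph {
  num_vertices : nat;
  adj : rel 'I_num_vertices;
  adj_sym : symmetric adj;
  adj_irr : irreflexive adj }.

Coercion graph_of_irrefl (G : irrefl_graph) : graph := Graph (@adj_sym G).

Definition is_hom (G H : graph) (h : {ffun G -> H}) : bool :=
  [forall x, forall y, edge x y ==> edge (h x) (h y)].

Definition is_surj (G H : graph) (h : {ffun G -> H}) : bool :=
  [forall y, exists x, h x == y].

Definition num_hom (G H : graph) : nat := #|[set h : {ffun G -> H} | is_hom h]|.

Definition num_shom (G H : graph) : nat :=
  #|[set h : {ffun G -> H} | is_hom h && is_surj h]|.

(* Canonical binary expansion, least significant bit first. [up_log 2 n.+1] is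
   the bit length of n, so 0 is written as the empty word. *)
Definition binary (n : nat) : seq bool :=
  mkseq (fun i => odd (n %/ 2 ^ i)) (up_log 2 n.+1).

(* 1^n 0 followed by the n ^ 2 entries of the adjacency matrix, row by row. *)
Definition encode_graph (G : irrefl_graph) : seq bool :=
  nseq (num_vertices G) true ++
  false :: [seq adj i j | i <- enum 'I_(num_vertices G),
                          j <- enum 'I_(num_vertices G)].

(* The encoding determines the instance, so oracles consistent with a problem on
   graphs (see [oracle_for]) exist. *)
Lemma encode_graph_inj (G G' : irrefl_graph) :
  encode_graph G = encode_graph G' ->
  exists e : num_vertices G = num_vertices G',
    forall i j, adj i j = adj (cast_ord e i) (cast_ord e j).
Proof.
case: G G' => n a sa ia [n' a' sa' ia']; rewrite /encode_graph /= => eqe.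
have en : n = n'.
  have idx m s : index false (nseq m true ++ false :: s) = m.
    by elim: m => //= m ->.
  by rewrite -(idx n [seq a i j | i <- enum 'I_n, j <- enum 'I_n]) eqe idx.
subst n'; exists erefl => i j; rewrite !cast_ord_id.
move/eqP: eqe; rewrite eqseq_cat // eqxx /= eqseq_cons /= => /eqP.
suff eqa (s t : seq 'I_n) :
    [seq a x y | x <- s, y <- t] = [seq a' x y | x <- s, y <- t] ->
    {in s & t, forall x y, a x y = a' x y}.
  by move/eqa; apply; rewrite mem_enum.
elim: s => [|x0 s IHs] //= /eqP.
rewrite eqseq_cat ?size_map // => /andP[/eqP/eq_in_map eq0 /eqP eqs] x y.
by rewrite inE => /predU1P[->|xs] yt; [apply: eq0 | apply: IHs].
Qed.

(* Tape symbols are 0, 1 and the blank [None]. A two-way infinite tape is a pair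
   (l, r): l lists the cells left of the head, nearest first, r the scanned
   cell and those right of it; all cells not listed are blank. *)
Definition symbol := option bool.
Definition tape := (seq symbol * seq symbol)%type.

Inductive move := Left | Stay | Right.

Definition read (t : tape) : symbol := head None t.2.

Definition write (s : symbol) (t : tape) : tape := (t.1, s :: behead t.2).

Definition shift (m : move) (t : tape) : tape :=
  match m with
  | Left => (behead t.1, head None t.1 :: t.2)
  | Stay => t
  | Right => (head None t.2 :: t.1, behead t.2)
  end.

Definition tape_of (w : seq bool) : tape := ([::], map Some w).

Fixpoint word_prefix (s : seq symbol) : seq bool :=
  if s is Some b :: s' then b :: word_prefix s' else [::].

(* The word from the scanned cell rightwards to the first blank. *)
Definition word_of (t : tape) : seq bool := word_prefix t.2.

(* [I] indexes the tapes and [Q] is the set of control states. [Step d] reads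
   all the scanned symbols, then writes and moves on every tape; [Query q]
   replaces the word on the oracle tape by its answer and enters state q. *)
Variant instruction (I Q : finType) :=
  | Halt
  | Query of Q
  | Step of ({ffun I -> symbol} -> Q * (I -> symbol * move)).
Arguments Halt {I Q}.
Arguments Query {I Q}.
Arguments Step {I Q}.

Record oracle_machine := OracleMachine {
  tape_index : finType;
  input_tape : tape_index;
  oracle_tape : tape_index;
  output_tape : tape_index;
  state : finType;
  start : state;
  program : state -> instruction tape_index state }.

Record config (M : oracle_machine) := Config {
  control : state M;
  tapes : {ffun tape_index M -> tape} }.

Definition init (M : oracle_machine) (w : seq bool) : config M :=
  Config (start M) [ffun i => tape_of (if i == input_tape M then w else [::])].

Definition step (M : oracle_machine) (O : seq bool -> seq bool)
    (c : config M) : config M :=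
  match program (control c) with
  | Halt => c
  | Query q =>
      Config q [ffun i => if i == oracle_tape M
                          then tape_of (O (word_of (tapes c i)))
                          else tapes c i]
  | Step d =>
      let: (q, act) := d [ffun i => read (tapes c i)] in
      Config q [ffun i => shift (act i).2 (write (act i).1 (tapes c i))]
  end.

Definition halted (M : oracle_machine) (c : config M) : bool :=
  if program (control c) is Halt then true else false.

Definition output (M : oracle_machine) (c : config M) : seq bool :=
  word_of (tapes c (output_tape M)).

Definition computes_within (M : oracle_machine) (O : seq bool -> seq bool)
    (t : nat) (w v : seq bool) : Prop :=
  let c := iter t (step O) (init M w) in halted c /\ output c = v.

Record counting_problem := CountingProblem {
  instance : Type;
  encode : instance -> seq bool;
  value : instance -> nat }.

(* Words that do not encode an instance may be answered arbitrarily. *)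
Definition oracle_for (P : counting_problem) (O : seq bool -> seq bool) : Prop :=
  forall x : instance P, O (encode x) = binary (value x).

Definition poly_turing_reducible (P1 P2 : counting_problem) : Prop :=
  exists (M : oracle_machine) (p : {poly nat}),
    forall O : seq bool -> seq bool, oracle_for P2 O ->
    forall x : instance P1,
      computes_within M O (p.[size (encode x)])%R (encode x) (binary (value x)).

Definition count_hom (H : graph) : counting_problem :=
  CountingProblem encode_graph (fun G => num_hom G H).

Definition count_shom (H : graph) : counting_problem :=
  CountingProblem encode_graph (fun G => num_shom G H).

(* Main.v *)
From HB Require Import structures.
From mathcomp Require Import all_boot all_order all_algebra zify.
Require Import Defs.

Set Implicit Arguments.
Unset Strict Implicit.
Unset Printing Implicit Defensive.
Import Order.TTheory GRing.Theory Num.Theory.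

(* Let q = |V(H)| and let pad G t be G with t isolated vertices added. By
   inclusion-exclusion over the image, the number of surjective homomorphisms
   from pad G t to H is the sum over the subsets A of V(H) of
   (-1)^(q - |A|) hom(G, H[A]) |A|^t. Weighting these numbers, for t <= q, by the
   coefficients of X (X - 1) ... (X - q + 1) kills every A except V(H) and leaves
   q! hom(G, H).

   The machine queries pad G 0, ..., pad G q. It keeps the word 1^n 0^t on the
   tapes [Col] and [Row], so that the padded adjacency matrix is written by a
   nested loop which reads one input bit for each 1 of [Col]. The answers, least
   significant bit first, are combined by a single left-to-right pass with a
   bounded carry, and the division by q! is a right-to-left long division in
   place, which also erases the leading zeros. *)

(** * Inclusion-exclusion for surjective homomorphisms *)

Section Padding.
Variables (G : irrefl_graph) (t : nat).
Let n := num_vertices G.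

Definition pad_adj : rel 'I_(n + t) := fun x y =>
  match split x, split y with inl i, inl j => adj i j | _, _ => false end.

Lemma pad_adj_sym : symmetric pad_adj.
Proof.
by move=> x y; rewrite /pad_adj; case: split => i; case: split => j //; exact: adj_sym.
Qed.

Lemma pad_adj_irr : irreflexive pad_adj.
Proof. by move=> x; rewrite /pad_adj; case: split => i //; exact: adj_irr. Qed.

Definition pad : irrefl_graph := IrreflGraph pad_adj_sym pad_adj_irr.

End Padding.

Section InclusionExclusion.
Variables (G : irrefl_graph) (H : graph).
Let n := num_vertices G.

(** This is hom(K, H[A]), expressed by a condition on the image so that no induced subgraph has to
    be formed. *)
Definition num_hom_into (K : graph) (A : {set H}) : nat :=
  #|[set h : {ffun K -> H} | is_hom h && [forall x, h x \in A]]|.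

Lemma num_hom_into_setT (K : graph) : num_hom_into K setT = num_hom K H.
Proof.
apply: eq_card => h; rewrite !inE; case: is_hom => //=.
by apply/forallP => x; rewrite inE.
Qed.

(** The added vertices carry no edges, so a homomorphism from the padded graph is a homomorphism
    from G together with a free choice in A for each of the t new vertices; [glue] is this
    bijection. *)
Lemma num_hom_into_pad (t : nat) (A : {set H}) :
  num_hom_into (pad G t) A = (num_hom_into G A * #|A| ^ t)%N.
Proof.
pose glue (p : {ffun 'I_n -> H} * {ffun 'I_t -> H}) : {ffun 'I_(n + t) -> H} :=
  [ffun x => match split x with inl i => p.1 i | inr j => p.2 j end].
have glueL p i : glue p (lshift t i) = p.1 i.
  by rewrite ffunE (unsplitK (inl i)).
have glueR p j : glue p (rshift n j) = p.2 j.
  by rewrite ffunE (unsplitK (inr j)).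
have glue_inj : injective glue.
  move=> [h g] [h' g'] /ffunP e; congr (_, _); apply/ffunP => i.
    by have := e (lshift t i); rewrite !glueL.
  by have := e (rshift n i); rewrite !glueR.
have -> : (#|A| ^ t)%N = #|[set g : {ffun 'I_t -> H} | g \in ffun_on (mem A)]|.
  by rewrite cardsE card_ffun_on card_ord.
rewrite /num_hom_into -cardsX -(card_imset _ glue_inj); apply: eq_card => k.
apply/idP/imsetP => [|[[h g]]].
  rewrite inE => /andP[/forallP homk /forallP kA].
  exists ([ffun i => k (lshift t i)], [ffun j => k (rshift n j)]); last first.
    apply/ffunP => x; rewrite ffunE -{1}(splitK x).
    by case: (split x) => i /=; rewrite ffunE.
  rewrite !inE /= -andbA; apply/and3P; split.
  - apply/forallP => x; apply/forallP => y; apply/implyP => exy.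
    have := implyP (forallP (homk (lshift t x)) (lshift t y)).
    rewrite /= /pad_adj (unsplitK (inl x)) (unsplitK (inl y)) !ffunE.
    by apply.
  - by apply/forallP => x; rewrite ffunE.
  - by apply/ffun_onP => x; rewrite ffunE.
rewrite !inE /= => /andP[/andP[/forallP homh /forallP hA] /ffun_onP gA] ->.
apply/andP; split.
  apply/forallP => x; apply/forallP => y; apply/implyP.
  rewrite /= /pad_adj !ffunE; case: split => // i; case: split => // j.
  exact: implyP (forallP (homh i) j).
by apply/forallP => x; rewrite ffunE; case: split.
Qed.

Local Open Scope ring_scope.

(** Surjectivity is the product over v of 1 - [v is not in the image], which is then expanded. *)
Lemma surj_incl_excl (K : graph) (h : {ffun K -> H}) :
  (is_surj h)%:R = \sum_(A : {set H}) (-1) ^+ #|~: A| * [forall x, h x \in A]%:R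
  :> int.
Proof.
pose im := [set h x | x : K].
have -> : (is_surj h)%:R = \prod_(v : H) (1 + - (v \notin im)%:R) :> int.
  have [/forallP sur | /forallPn[v nv]] := boolP (is_surj h).
    rewrite big1 // => v _; case/existsP: (sur v) => x /eqP <-.
    by rewrite imset_f // subr0.
  rewrite (bigD1 v) //= -[X in (1 - X)](_ : 1 = _) ?subrr ?mul0r //.
  suff -> : v \notin im by [].
  apply: contra nv => /imsetP[x _ ->]; apply/existsP; by exists x.
(* A is the set of vertices whose factor contributes its 1; the others contribute minus the
   indicator of being missed, so the term survives only when the image lies in A. *)
rewrite bigA_distr; apply: eq_bigr => A _.
rewrite (bigID [pred v | v \in A]) /= big1 ?mul1r => [|v ->//].
under eq_bigr => v /negPf -> do rewrite -mulN1r.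
rewrite big_split /= prodr_const; congr (_ ^+ _ * _).
  by apply: eq_card => v; rewrite !inE.
have [/forallP hA | /forallPn[x nx]] := boolP [forall x, h x \in A].
  rewrite big1 // => v nv; suff -> : v \notin im by [].
  by apply: contra nv => /imsetP[x _ ->]; exact: hA.
by rewrite (bigD1 (h x)) //= imset_f // mul0r.
Qed.

Lemma card_natr_sum (T : finType) (P : pred T) :
  #|[set x | P x]|%:R = \sum_x (P x)%:R :> int.
Proof.
rewrite -sum1_card natr_sum big_mkcond.
by apply: eq_bigr => x _; rewrite inE; case: (P x).
Qed.

Lemma num_shom_incl_excl (K : graph) :
  (num_shom K H)%:R =
  \sum_(A : {set H}) (-1) ^+ #|~: A| * (num_hom_into K A)%:R :> int.
Proof.
rewrite /num_shom card_natr_sum.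
under [RHS]eq_bigr do rewrite card_natr_sum mulr_sumr.
rewrite exchange_big; apply: eq_bigr => h _ /=.
case: is_hom => /=; first exact: surj_incl_excl.
by under eq_bigr do rewrite mulr0; rewrite big1.
Qed.

Definition falling_poly (q : nat) : {poly int} := \prod_(j < q) ('X - (j%:R)%:P).

(** The roots are 0, ..., q - 1, and at q the factors are q, ..., 1. *)
Lemma horner_falling_poly (q m : nat) :
  (m <= q)%N -> (falling_poly q).[m%:R] = (q`! * (m == q))%:R.
Proof.
move=> mq; rewrite horner_prod; under eq_bigr do rewrite hornerXsubC.
have [->|ne] := eqVneq m q.
  rewrite muln1 fact_prod natr_prod big_add1 /= big_mkord.
  rewrite (reindex_inj rev_ord_inj) /=; apply: eq_bigr => j _.
  by rewrite -natrB ?leq_subr // subKn.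
have {ne}mq : (m < q)%N by rewrite ltn_neqAle ne.
by rewrite muln0 (bigD1 (Ordinal mq)) //= subrr mul0r.
Qed.

(** After the two sums are exchanged, the term of A has as a factor the value of the falling
    polynomial at [#|A|], which is 0 unless A is all of V(H). *)
Lemma num_hom_from_shom :
  \sum_(t < #|H|.+1) (falling_poly #|H|)`_t * (num_shom (pad G t) H)%:R
  = (#|H|`! * num_hom G H)%:R.
Proof.
under eq_bigr do rewrite num_shom_incl_excl mulr_sumr.
rewrite exchange_big /= (bigD1 setT) //= [X in _ + X]big1 => [|A nA].
  rewrite setCT cards0 expr0; under eq_bigr do
    rewrite num_hom_into_pad cardsT num_hom_into_setT mul1r natrM natrX mulrCA.
  (* The polynomial has degree [#|H|], so the sum over t is its full evaluation. *)
  rewrite -mulr_sumr -horner_coef_wide ?horner_falling_poly //.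
    by rewrite eqxx muln1 addr0 -natrM mulnC.
  by rewrite size_prod_XsubC -[index_enum _]enumT size_enum_ord.
under eq_bigr do rewrite num_hom_into_pad natrM natrX [X in _ * X]mulrA mulrCA.
rewrite -mulr_sumr.
have -> : \sum_(i < #|H|.+1) (falling_poly #|H|)`_i * #|A|%:R ^+ i = 0.
  rewrite -horner_coef_wide ?horner_falling_poly ?max_card //.
    rewrite (_ : #|A| == #|H| = false) ?muln0 //.
    by apply: contraNF nA; rewrite -cardsT -subset_leqif_cards ?subsetT // eq_sym.
  by rewrite size_prod_XsubC -[index_enum _]enumT size_enum_ord.
by rewrite mulr0.
Qed.

End InclusionExclusion.

(** * Words *)

Definition entries (G : irrefl_graph) : seq bool :=
  [seq adj i j | i <- enum 'I_(num_vertices G), j <- enum 'I_(num_vertices G)].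

(** Letters missing from s count as false. Once the entries of G are used up, the same operation
    therefore yields the zero rows of the added vertices. *)
Definition pad_row (n t : nat) (s : seq bool) : seq bool :=
  take n s ++ nseq (n - size (take n s) + t) false.

Fixpoint pad_rows (n t k : nat) (s : seq bool) : seq bool :=
  if k is k'.+1 then pad_row n t s ++ pad_rows n t k' (drop n s) else [::].

Lemma size_pad_row n t s : size (pad_row n t s) = n + t.
Proof. rewrite /pad_row size_cat size_nseq; have := size_take n s; case: ltnP; lia. Qed.

Lemma size_pad_rows n t k s : size (pad_rows n t k s) = k * (n + t).
Proof. by elim: k s => //= k IH s; rewrite size_cat size_pad_row IH. Qed.

Lemma pad_rows_nil n t k : pad_rows n t k [::] = nseq (k * (n + t)) false.
Proof. by elim: k => //= k IH; rewrite IH /pad_row /= subn0 -nseqD mulSn. Qed.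

Lemma enum_ord_cat (m n : nat) :
  enum 'I_(m + n) = map (@lshift m n) (enum 'I_m) ++ map (@rshift m n) (enum 'I_n).
Proof.
apply: (inj_map val_inj); rewrite map_cat val_enum_ord iotaD.
rewrite -(map_comp val (@lshift m n)) -(map_comp val (@rshift m n)).
congr (_ ++ _); first by rewrite -(val_enum_ord m); apply: eq_map.
by rewrite add0n -[X in iota X]addn0 iotaDl -(val_enum_ord n) -map_comp; apply: eq_map.
Qed.

Lemma map_constant (S T : Type) (f : S -> T) c (s : seq S) :
  f =1 (fun=> c) -> map f s = nseq (size s) c.
Proof. by move=> fc; elim: s => //= x s ->; rewrite fc. Qed.

Lemma pad_rows_cat n t k (rows : seq (seq bool)) s :
  all (fun r => size r == n) rows ->
  pad_rows n t (size rows + k) (flatten rows ++ s) =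
  flatten [seq r ++ nseq t false | r <- rows] ++ pad_rows n t k s.
Proof.
elim: rows => //= r rows IH /andP[/eqP sr /IH{}IH].
by rewrite /pad_row -!catA take_size_cat ?drop_size_cat // IH sr subnn add0n.
Qed.

(** An old vertex has its row of G followed by t zeros, and a new vertex has a zero row, which is
    what [pad_rows] produces from an exhausted stream. *)
Lemma encode_pad (G : irrefl_graph) (t : nat) :
  let n := num_vertices G in
  encode_graph (pad G t) =
  nseq (n + t) true ++ false :: pad_rows n t (n + t) (entries G).
Proof.
move=> n; rewrite /encode_graph /=; congr (_ ++ _ :: _).
have adjL (i j : 'I_n) : pad_adj (lshift t i) (lshift t j) = adj i j.
  by rewrite /pad_adj (unsplitK (inl i)) (unsplitK (inl j)).
have adjR (i : 'I_n) (j : 'I_t) : pad_adj (lshift t i) (rshift n j) = false.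
  by rewrite /pad_adj (unsplitK (inl i)) (unsplitK (inr j)).
have adjRR (i : 'I_t) x : pad_adj (rshift n i) x = false.
  by rewrite /pad_adj (unsplitK (inr i)).
have -> : [seq pad_adj x y | x <- enum 'I_(n + t), y <- enum 'I_(n + t)] =
    [seq pad_adj (lshift t i) y | i <- enum 'I_n, y <- enum 'I_(n + t)] ++
    [seq pad_adj (rshift n i) y | i <- enum 'I_t, y <- enum 'I_(n + t)].
  rewrite [X in flatten (map _ X) = _]enum_ord_cat map_cat flatten_cat.
  by rewrite -(map_comp _ (@lshift n t)) -(map_comp _ (@rshift n t)).
have -> : [seq pad_adj (rshift n i) y | i <- enum 'I_t, y <- enum 'I_(n + t)]
          = pad_rows n t t [::].
  rewrite pad_rows_nil -[X in X * _](size_enum_ord t).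
  elim: (enum 'I_t) => //= i s ->.
  by rewrite mulSn nseqD (map_constant _ (adjRR i)) size_enum_ord.
pose rows := [seq [seq adj i j | j <- enum 'I_n] | i <- enum 'I_n].
have srows : size rows = n by rewrite size_map size_enum_ord.
have rows_n : all (fun r => size r == n) rows.
  by apply/allP => r /mapP[i _ ->]; rewrite size_map size_enum_ord.
have := pad_rows_cat t t [::] rows_n; rewrite cats0 srows => ->.
rewrite -(map_comp (cat^~ _)); congr (flatten _ ++ _).
apply: eq_map => i /=; rewrite enum_ord_cat map_cat.
rewrite -(map_comp _ (@lshift n t)) -(map_comp _ (@rshift n t)); congr (_ ++ _).
  by apply: eq_map => j; exact: adjL.
by rewrite (map_constant _ (adjR i)) size_enum_ord.
Qed.

Lemma rcons_nseq (X : Type) (x : X) k : rcons (nseq k x) x = nseq k.+1 x.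
Proof. by elim: k => //= k ->. Qed.

(** * Binary numerals, least significant bit first *)

Definition num_of_bits (s : seq bool) : nat := foldr (fun (b : bool) m => b + m.*2) 0 s.

(** The exception at 0 reflects that numerals have no leading zeros. The same case distinction
    governs the writing of quotient bits in [div_run]. *)
Lemma binary_cons (b : bool) (m : nat) :
  binary (b + m.*2) = if b + m.*2 == 0 then [::] else b :: binary m.
Proof.
have [-> //|nz] := eqVneq; rewrite /binary up_log2S ?lt0n //.
have -> : (b + m.*2)./2 = m by rewrite half_bit_double.
rewrite /mkseq /= expn0 divn1 oddD odd_double addbF; congr (_ :: _).
  by case: b {nz}.
rewrite (iotaDl 1 0) -map_comp; apply: eq_map => i /=.
by rewrite expnS divnMA divn2 half_bit_double.
Qed.

Lemma num_of_binary (m : nat) : num_of_bits (binary m) = m.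
Proof.
have [k] := ubnP m; elim: k m => // k IH m; rewrite ltnS => mk.
have [-> //|m0] := posnP m.
rewrite -{1}(odd_double_half m) binary_cons odd_double_half eqn0Ngt m0 /=.
by rewrite IH ?odd_double_half //; lia.
Qed.

(** The default bit makes this hold for the empty word too, so an exhausted answer can go on
    contributing zeros to the addition. *)
Lemma num_of_bits_head (s : seq bool) :
  num_of_bits s = head false s + (num_of_bits (behead s)).*2.
Proof. by case: s. Qed.

Lemma num_of_bits_rcons u b :
  num_of_bits (rcons u b) = num_of_bits u + b * 2 ^ size u.
Proof. elim: u => [|c u /= ->]; rewrite /= ?expn0 ?expnS; lia. Qed.

Lemma size_binary_le (m k : nat) : m < 2 ^ k -> size (binary m) <= k.
Proof. by move=> mk; rewrite size_mkseq up_log_min. Qed.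

(** * Tapes and runs up to trailing blanks *)

(** Reading beyond the list gives a blank, so lists that differ only by trailing blanks describe the
    same half-tape. *)
Definition side_eq (s s' : seq symbol) : Prop := nth None s =1 nth None s'.

Definition tape_eq (t t' : tape) : Prop := side_eq t.1 t'.1 /\ side_eq t.2 t'.2.

Definition config_eq (M : oracle_machine) (c c' : config M) : Prop :=
  control c = control c' /\ forall i, tape_eq (tapes c i) (tapes c' i).

Lemma tape_eq_refl t : tape_eq t t. Proof. by []. Qed.
#[local] Hint Resolve tape_eq_refl : core.

Lemma tape_eq_trans t1 t2 t3 : tape_eq t1 t2 -> tape_eq t2 t3 -> tape_eq t1 t3.
Proof.
by case=> e1 e2 [e3 e4]; split=> k; rewrite ?e1 ?e2.
Qed.

Lemma side_eq_cons x s s' : side_eq s s' -> side_eq (x :: s) (x :: s').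
Proof. by move=> e [|k] //=. Qed.

Lemma side_eq_behead s s' : side_eq s s' -> side_eq (behead s) (behead s').
Proof. by move=> e k; rewrite !nth_behead. Qed.

Lemma side_eq_head s s' : side_eq s s' -> head None s = head None s'.
Proof. by move=> e; rewrite -!nth0. Qed.

Lemma side_eq_blank s : side_eq (head None s :: behead s) s.
Proof. by case: s => // -[|[]]. Qed.

Lemma shift_write_eq x m t t' :
  tape_eq t t' -> tape_eq (shift m (write x t)) (shift m (write x t')).
Proof.
case: t t' => l r [l' r'] [/= el er].
case: m; split=> /=; rewrite ?(side_eq_head el);
  by do ?[apply: side_eq_cons | apply: side_eq_behead].
Qed.

Lemma word_of_eq t t' : tape_eq t t' -> word_of t = word_of t'.
Proof.
case: t t' => l r [l' r'] [_ /= er]; rewrite /word_of /=.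
elim: r r' er => [|x r IH] [|x' r'] er //=.
- by have := er 0 => /= <-.
- by have := er 0 => /= ->.
have := er 0 => /= ->; case: x' {er} (side_eq_behead er) => //= b er.
by rewrite (IH _ er).
Qed.

Section Runs.
Variables (M : oracle_machine) (O : seq bool -> seq bool).
Implicit Types c : config M.

Lemma config_eq_trans c1 c2 c3 :
  config_eq c1 c2 -> config_eq c2 c3 -> config_eq c1 c3.
Proof.
by case=> e1 e2 [e3 e4]; split=> [|i]; [rewrite e1 | apply: tape_eq_trans (e4 i)].
Qed.

Lemma step_eq c c' : config_eq c c' -> config_eq (step O c) (step O c').
Proof.
case: c c' => q T [q' T'] [/= <- eT]; rewrite /step /=.
case: (program q) => [|q1|d] //.
  split=> //= i; rewrite !ffunE; case: eqP => // _.
  by rewrite (word_of_eq (eT i)).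
have -> : [ffun i => read (T i)] = [ffun i => read (T' i)] :> {ffun _}.
  by apply/ffunP => i; rewrite !ffunE /read (side_eq_head (proj2 (eT i))).
case: (d _) => q1 act; split=> //= i; rewrite !ffunE; exact: shift_write_eq.
Qed.

Lemma iter_step_eq k c c' :
  config_eq c c' -> config_eq (iter k (step O) c) (iter k (step O) c').
Proof. by move=> e; elim: k => //= k; exact: step_eq. Qed.

(** Here k is only an upper bound on the number of steps, which allows time bounds to be rounded up;
    the target is determined up to trailing blanks. *)
Definition reach (k : nat) (c c' : config M) : Prop :=
  exists2 j, j <= k & config_eq (iter j (step O) c) c'.

Lemma reach_refl k c : reach k c c. Proof. by exists 0. Qed.

Lemma reach_trans k1 k2 c1 c2 c3 :
  reach k1 c1 c2 -> reach k2 c2 c3 -> reach (k1 + k2) c1 c3.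
Proof.
case=> j1 le1 e1 [j2 le2 e2]; exists (j2 + j1); first by rewrite addnC leq_add.
by rewrite iterD; apply: config_eq_trans e2; apply: iter_step_eq.
Qed.

Lemma reach_step k c c1 c' :
  config_eq (step O c) c1 -> reach k c1 c' -> reach k.+1 c c'.
Proof. by move=> e r; apply: (@reach_trans 1 k _ c1) => //; exists 1. Qed.

Lemma reach_le k k' c c' : k <= k' -> reach k c c' -> reach k' c c'.
Proof. by move=> le [j lej e]; exists j => //; exact: leq_trans le. Qed.

Lemma reach_eq k c c1 c2 : reach k c c1 -> config_eq c1 c2 -> reach k c c2.
Proof. by case=> j jk e e'; exists j => //; apply: config_eq_trans e'. Qed.

Lemma eq_reach k c c1 c2 : config_eq c c1 -> reach k c1 c2 -> reach k c c2.
Proof. by move=> e; apply: (@reach_trans 0); exists 0. Qed.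

Lemma halted_stable k c : halted c -> iter k (step O) c = c.
Proof.
move=> hc; elim: k => //= k ->; move: hc; rewrite /halted /step.
by case: program.
Qed.

(** A halted configuration is fixed by [step], so running on until time k changes nothing, and the
    output word does not see trailing blanks. *)
Lemma reach_computes k w c :
  reach k (init M w) c -> halted c -> computes_within M O k w (output c).
Proof.
case=> j jk [ec eT] hc; rewrite /computes_within -(subnK jk) iterD.
have hj : halted (iter j (step O) (init M w)) by rewrite /halted ec.
by rewrite halted_stable //; split=> //; exact: word_of_eq.
Qed.

Lemma computes_within_le k k' w v :
  k <= k' -> computes_within M O k w v -> computes_within M O k' w v.
Proof.
move=> kk' [hc <-]; rewrite /computes_within -(subnK kk') iterD.
by rewrite halted_stable.
Qed.

End Runs.

(** Every [Step] writes on every tape, so a pure move rewrites the scanned symbol. This may turn an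
    unlisted blank into a listed one. *)
Definition keep_shift (m : move) (t : tape) : tape := shift m (write (read t) t).
Arguments keep_shift : simpl never.

(* The word [u ++ v], preceded by a blank and then by [l], scanned at the first
   letter of [v] (or just after the word). *)
Definition at_word (l : seq symbol) (u v : seq bool) : tape :=
  (map Some (rev u) ++ None :: l, map Some v).

(* Same word, scanned at the last letter of [u] (or just before the word). *)
Definition before_word (l : seq symbol) (u v : seq bool) : tape :=
  shift Left (at_word l u v).

Lemma tape_of_at_word w : tape_eq (tape_of w) (at_word [::] [::] w).
Proof. by split=> //= -[|[]]. Qed.

Lemma before_word_rcons l u b v : before_word l (rcons u b) v = at_word l u (b :: v).
Proof. by rewrite /before_word /at_word /shift /= rev_rcons. Qed.

Lemma read_before_rcons l u b v : read (before_word l (rcons u b) v) = Some b.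
Proof. by rewrite before_word_rcons. Qed.

Lemma read_before_nil l v : read (before_word l [::] v) = None.
Proof. by []. Qed.

Lemma write_read x t : read t = x -> tape_eq (write x t) t.
Proof. by move<-; split=> //=; exact: side_eq_blank. Qed.

Lemma keep_right_cons l u b v :
  tape_eq (keep_shift Right (at_word l u (b :: v))) (at_word l (rcons u b) v).
Proof. by rewrite /keep_shift /at_word /= rev_rcons. Qed.

Lemma write_right_end l u b :
  tape_eq (shift Right (write (Some b) (at_word l u [::]))) (at_word l (rcons u b) [::]).
Proof. by rewrite /at_word /= rev_rcons. Qed.

Lemma keep_left_at l u v :
  tape_eq (keep_shift Left (at_word l u v)) (before_word l u v).
Proof.
split=> //=; apply: side_eq_cons; exact: side_eq_blank.
Qed.

Lemma keep_left_before l u b v :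
  tape_eq (keep_shift Left (before_word l (rcons u b) v)) (before_word l u (b :: v)).
Proof. by rewrite before_word_rcons; exact: keep_left_at. Qed.

(** * The machine *)

(** [Col] and [Row] are the counters for the columns and rows of the padded matrix; [Ans t] stores
    the answer to the t-th query. *)
Inductive tape_name (T : Type) :=
  In | Col | Row | Orc | Out | Ans of T.
Arguments In {T}. Arguments Col {T}. Arguments Row {T}.
Arguments Orc {T}. Arguments Out {T}.

(** An injection into a finite type, from which the [finType] structure is transported. *)
Definition tape_name_code T (i : tape_name T) : T + bool * bool * bool :=
  match i with
  | Ans t => inl t
  | In => inr (false, false, false)
  | Col => inr (false, false, true)
  | Row => inr (false, true, false)
  | Orc => inr (false, true, true)
  | Out => inr (true, false, false)
  end.

Definition tape_name_decode T (x : T + bool * bool * bool) : tape_name T :=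
  match x with
  | inl t => Ans t
  | inr (false, false, false) => In
  | inr (false, false, true) => Col
  | inr (false, true, false) => Row
  | inr (false, true, true) => Orc
  | inr (true, _, _) => Out
  end.

Lemma tape_name_codeK T : cancel (@tape_name_code T) (@tape_name_decode T).
Proof. by case. Qed.

HB.instance Definition _ (T : finType) :=
  Finite.copy (tape_name T) (can_type (@tape_name_codeK T)).

(** [Header] writes 1^N 0, [NextRow] returns [Col] to its start, [Fill] writes one matrix row,
    [Copy] moves the answer to its own tape, and the rewinding phases restore head positions. *)
Variant phase := Header | NextRow | Fill | RewindIn | RewindOrc | Ask | Copy | RewindAns.

Definition phase_code (p : phase) : bool * bool * bool :=
  match p with
  | Header => (false, false, false)
  | NextRow => (false, false, true)
  | Fill => (false, true, false)
  | RewindIn => (false, true, true)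
  | RewindOrc => (true, false, false)
  | Ask => (true, false, true)
  | Copy => (true, true, false)
  | RewindAns => (true, true, true)
  end.

Definition phase_decode (x : bool * bool * bool) : phase :=
  match x with
  | (false, false, false) => Header
  | (false, false, true) => NextRow
  | (false, true, false) => Fill
  | (false, true, true) => RewindIn
  | (true, false, false) => RewindOrc
  | (true, false, true) => Ask
  | (true, true, false) => Copy
  | (true, true, true) => RewindAns
  end.

Lemma phase_codeK : cancel phase_code phase_decode.
Proof. by case. Qed.

HB.instance Definition _ := Finite.copy phase (can_type phase_codeK).

(* [Loop p t] is phase p of the t-th oracle call; [Add e] is the addition with
   carry e; [Div r f] is the long division with partial remainder r, where f
   tells whether a nonzero quotient bit has been written. *)
Variant control_state (T E R : Type) :=
  Scan | Loop of phase & T | Add of E | Div of R & bool | Done.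
Arguments Scan {T E R}. Arguments Loop {T E R}.
Arguments Add {T E R}. Arguments Div {T E R}. Arguments Done {T E R}.

Definition control_code T E R (s : control_state T E R) :
    (phase * T + E) + (R * bool + bool) :=
  match s with
  | Scan => inr (inr true)
  | Loop p t => inl (inl (p, t))
  | Add e => inl (inr e)
  | Div r f => inr (inl (r, f))
  | Done => inr (inr false)
  end.

Definition control_decode T E R (x : (phase * T + E) + (R * bool + bool)) :
    control_state T E R :=
  match x with
  | inr (inr true) => Scan
  | inl (inl (p, t)) => Loop p t
  | inl (inr e) => Add e
  | inr (inl (r, f)) => Div r f
  | inr (inr false) => Done
  end.

Lemma control_codeK T E R : cancel (@control_code T E R) (@control_decode T E R).
Proof. by case. Qed.

HB.instance Definition _ (T E R : finType) :=
  Finite.copy (control_state T E R) (can_type (@control_codeK T E R)).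

(** * The program, for arbitrary integer weights [coef] and divisor [den] *)

Section Machine.
Variables (q : nat) (coef : 'I_q.+1 -> int) (den : nat).

Let T : finType := 'I_q.+1.
Let I : finType := tape_name T.

(** Call this B. Each column of bits has a weighted sum in [-B, B], and halving the sum of two
    numbers of this interval stays inside it. Hence the carry is bounded and fits in the control
    state. *)
Definition coef_bound : nat := \sum_t absz (coef t).

(* The signed carry c of the addition is stored as the natural number
   c + [coef_bound], and [weight] shifts the coefficients accordingly. *)
Definition weight (t : T) (b : bool) : nat :=
  absz ((absz (coef t))%:Z + coef t * b%:R)%R.

Let E : finType := 'I_(coef_bound.*2).+1.
Let Q : finType := control_state T E 'I_den.+1.

(** The addition starts with carry 0, stored as [coef_bound]. *)
Definition next_call (t : T) : Q :=
  if t < q then Loop Header (inord t.+1) else Add (inord coef_bound).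

(** The separating 0 of the input is replaced by a blank, which later marks the left end of the
    matrix entries for [RewindIn]. *)
Definition scan_step (v : {ffun I -> symbol}) : Q * (I -> symbol * move) :=
  if v In == Some true then
    (Scan, fun i => match i with
      | In => (v i, Right)
      | Col | Row => (Some true, Right)
      | _ => (v i, Stay) end)
  else
    (Loop Header ord0, fun i => match i with
      | In => (None, Right)
      | Col | Row => (v i, Left)
      | _ => (v i, Stay) end).

(** In [Fill], a 1 of [Col] takes the next input bit and a 0 stands for an added column; the head of
    [Row] advances once per matrix row. The end of [RewindAns] appends a 0 to both counters, ready
    for one more isolated vertex. *)
Definition loop_step (p : phase) (t : T) (v : {ffun I -> symbol}) :
    Q * (I -> symbol * move) :=
  match p with
  | Header =>
      if v Col then
        (Loop Header t, fun i => match i with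
          | Col | Row => (v i, Left)
          | Orc => (Some true, Right)
          | _ => (v i, Stay) end)
      else
        (Loop NextRow t, fun i => match i with
          | Row => (v i, Right)
          | Orc => (Some false, Right)
          | _ => (v i, Stay) end)
  | NextRow =>
      if v Col then
        (Loop NextRow t, fun i => match i with
          | Col => (v i, Left)
          | _ => (v i, Stay) end)
      else
        (Loop Fill t, fun i => match i with
          | Col | Row => (v i, Right)
          | _ => (v i, Stay) end)
  | Fill =>
      match v Col with
      | Some b =>
          (Loop Fill t, fun i => match i with
            | In => (v i, if b && isSome (v i) then Right else Stay)
            | Col => (v i, Right)
            | Orc => (Some (b && odflt false (v In)), Right)
            | _ => (v i, Stay) end)
      | None =>
          if v Row then
            (Loop NextRow t, fun i => match i with
              | Col => (v i, Left)
              | _ => (v i, Stay) end)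
          else
            (Loop RewindIn t, fun i => match i with
              | In | Orc => (v i, Left)
              | _ => (v i, Stay) end)
      end
  | RewindIn =>
      (Loop (if v In then RewindIn else RewindOrc) t, fun i => match i with
        | In => (v i, if v In then Left else Right)
        | _ => (v i, Stay) end)
  | RewindOrc =>
      (Loop (if v Orc then RewindOrc else Ask) t, fun i => match i with
        | Orc => (v i, if v Orc then Left else Right)
        | _ => (v i, Stay) end)
  | Ask => (Loop Copy t, fun i => (v i, Stay))
  | Copy =>
      if v Orc then
        (Loop Copy t, fun i => match i with
          | Orc => (None, Right)
          | Ans u => if u == t then (v Orc, Right) else (v i, Stay)
          | _ => (v i, Stay) end)
      else
        (Loop RewindAns t, fun i => match i with
          | Ans u => (v i, if u == t then Left else Stay)
          | _ => (v i, Stay) end)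
  | RewindAns =>
      if v (Ans t) then
        (Loop RewindAns t, fun i => match i with
          | Ans u => (v i, if u == t then Left else Stay)
          | _ => (v i, Stay) end)
      else
        (next_call t, fun i => match i with
          | Ans u => (v i, if u == t then Right else Stay)
          | Col | Row => (Some false, Stay)
          | _ => (v i, Stay) end)
  end.

(** The pass may continue beyond the longest answer: it ends only when the signed carry is 0 as
    well. *)
Definition add_step (e : E) (v : {ffun I -> symbol}) : Q * (I -> symbol * move) :=
  if [forall t, v (Ans t) == None] && (e == coef_bound :> nat) then
    (Div ord0 false, fun i => match i with
      | Out => (v i, Left)
      | _ => (v i, Stay) end)
  else
    let m := e + \sum_t weight t (odflt false (v (Ans t))) in
    (Add (inord m./2), fun i => match i with
      | Out => (Some (odd m), Right)
      | Ans _ => (v i, Right)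
      | _ => (v i, Stay) end).

(** One step of schoolbook division: the scanned bit is brought down to the remainder and
    overwritten by the quotient bit, or by a blank while the quotient is still 0. *)
Definition div_step (r : 'I_den.+1) (f : bool) (v : {ffun I -> symbol}) :
    Q * (I -> symbol * move) :=
  match v Out with
  | Some b =>
      let m := b + r.*2 in
      let f' := f || (den <= m) in
      (Div (inord (m %% den)) f', fun i => match i with
        | Out => (if f' then Some (den <= m) else None, Left)
        | _ => (v i, Stay) end)
  | None =>
      (Done, fun i => match i with
        | Out => (v i, Right)
        | _ => (v i, Stay) end)
  end.

Definition combine_program (s : Q) : instruction I Q :=
  match s with
  | Scan => Step scan_step
  | Loop Ask t => Query (Loop Copy t)
  | Loop p t => Step (loop_step p t)
  | Add e => Step (add_step e)
  | Div r f => Step (div_step r f)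
  | Done => Halt
  end.

Definition combine_machine : oracle_machine :=
  OracleMachine (In : I) Orc Out (Scan : Q) combine_program.

Definition tapes_of (tin tcol trow torc tout : tape) (tans : T -> tape) (i : I) : tape :=
  match i with
  | In => tin | Col => tcol | Row => trow | Orc => torc | Out => tout
  | Ans t => tans t
  end.

Definition conf (s : Q) tin tcol trow torc tout tans : config combine_machine :=
  @Config combine_machine s [ffun i => tapes_of tin tcol trow torc tout tans i].

Lemma conf_eq s tin tcol trow torc tout tans tin' tcol' trow' torc' tout' tans' :
  tape_eq tin tin' -> tape_eq tcol tcol' -> tape_eq trow trow' ->
  tape_eq torc torc' -> tape_eq tout tout' ->
  (forall t, tape_eq (tans t) (tans' t)) ->
  config_eq (conf s tin tcol trow torc tout tans)
            (conf s tin' tcol' trow' torc' tout' tans').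
Proof. by move=> *; split=> //= i; rewrite !ffunE; case: i. Qed.

(** * Single steps of the machine *)

Variable O : seq bool -> seq bool.

(** Computes one step from the reading equations h and compares the tapes one by one; an idle tape
    has its scanned symbol written back, which [write_read] absorbs. *)
Ltac run_step h :=
  rewrite /step /= /scan_step ?ffunE /= ?h /=; split=> //=; case=> [|||||?];
  rewrite !ffunE /= ?ffunE /= ?h /=;
  try (by [apply: write_read | rewrite /keep_shift h | apply: tape_eq_refl]).

Lemma scan_step_true tin tcol trow torc tout tans :
  read tin = Some true ->
  config_eq (step O (conf Scan tin tcol trow torc tout tans))
    (conf Scan (keep_shift Right tin) (shift Right (write (Some true) tcol))
      (shift Right (write (Some true) trow)) torc tout tans).
Proof. move=> h; run_step h. Qed.

Lemma scan_step_false tin tcol trow torc tout tans :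
  read tin = Some false ->
  config_eq (step O (conf Scan tin tcol trow torc tout tans))
    (conf (Loop Header ord0) (shift Right (write None tin)) (keep_shift Left tcol)
      (keep_shift Left trow) torc tout tans).
Proof. move=> h; run_step h. Qed.

Lemma header_step_some t b tin tcol trow torc tout tans :
  read tcol = Some b ->
  config_eq (step O (conf (Loop Header t) tin tcol trow torc tout tans))
    (conf (Loop Header t) tin (keep_shift Left tcol) (keep_shift Left trow)
      (shift Right (write (Some true) torc)) tout tans).
Proof. move=> h; run_step h. Qed.

Lemma header_step_none t tin tcol trow torc tout tans :
  read tcol = None ->
  config_eq (step O (conf (Loop Header t) tin tcol trow torc tout tans))
    (conf (Loop NextRow t) tin tcol (keep_shift Right trow)
      (shift Right (write (Some false) torc)) tout tans).
Proof. move=> h; run_step h. Qed.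

Lemma next_row_step_some t b tin tcol trow torc tout tans :
  read tcol = Some b ->
  config_eq (step O (conf (Loop NextRow t) tin tcol trow torc tout tans))
    (conf (Loop NextRow t) tin (keep_shift Left tcol) trow torc tout tans).
Proof. move=> h; run_step h. Qed.

Lemma next_row_step_none t tin tcol trow torc tout tans :
  read tcol = None ->
  config_eq (step O (conf (Loop NextRow t) tin tcol trow torc tout tans))
    (conf (Loop Fill t) tin (keep_shift Right tcol) (keep_shift Right trow)
      torc tout tans).
Proof. move=> h; run_step h. Qed.

Lemma fill_step_true t b tin tcol trow torc tout tans :
  read tcol = Some true -> read tin = Some b ->
  config_eq (step O (conf (Loop Fill t) tin tcol trow torc tout tans))
    (conf (Loop Fill t) (keep_shift Right tin) (keep_shift Right tcol) trow
      (shift Right (write (Some b) torc)) tout tans).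
Proof. move=> h h'; run_step (h, h'). Qed.

(** The two alternatives are an added column and an added row: in the latter the input is
    exhausted. *)
Lemma fill_step_false t b tin tcol trow torc tout tans :
  read tcol = Some b -> b = false \/ read tin = None ->
  config_eq (step O (conf (Loop Fill t) tin tcol trow torc tout tans))
    (conf (Loop Fill t) tin (keep_shift Right tcol) trow
      (shift Right (write (Some false) torc)) tout tans).
Proof.
move=> h [eb|h']; first by move: h; rewrite eb => h; run_step h.
run_step (h, h'); rewrite andbF //; exact: write_read.
Qed.

Lemma fill_step_row t b tin tcol trow torc tout tans :
  read tcol = None -> read trow = Some b ->
  config_eq (step O (conf (Loop Fill t) tin tcol trow torc tout tans))
    (conf (Loop NextRow t) tin (keep_shift Left tcol) trow torc tout tans).
Proof. move=> h h'; run_step (h, h'). Qed.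

Lemma fill_step_end t tin tcol trow torc tout tans :
  read tcol = None -> read trow = None ->
  config_eq (step O (conf (Loop Fill t) tin tcol trow torc tout tans))
    (conf (Loop RewindIn t) (keep_shift Left tin) tcol trow
       (keep_shift Left torc) tout tans).
Proof. move=> h h'; run_step (h, h'). Qed.

Lemma rewind_in_step_some t b tin tcol trow torc tout tans :
  read tin = Some b ->
  config_eq (step O (conf (Loop RewindIn t) tin tcol trow torc tout tans))
    (conf (Loop RewindIn t) (keep_shift Left tin) tcol trow torc tout tans).
Proof. move=> h; run_step h. Qed.

Lemma rewind_in_step_none t tin tcol trow torc tout tans :
  read tin = None ->
  config_eq (step O (conf (Loop RewindIn t) tin tcol trow torc tout tans))
    (conf (Loop RewindOrc t) (keep_shift Right tin) tcol trow torc tout tans).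
Proof. move=> h; run_step h. Qed.

Lemma rewind_orc_step_some t b tin tcol trow torc tout tans :
  read torc = Some b ->
  config_eq (step O (conf (Loop RewindOrc t) tin tcol trow torc tout tans))
    (conf (Loop RewindOrc t) tin tcol trow (keep_shift Left torc) tout tans).
Proof. move=> h; run_step h. Qed.

Lemma rewind_orc_step_none t tin tcol trow torc tout tans :
  read torc = None ->
  config_eq (step O (conf (Loop RewindOrc t) tin tcol trow torc tout tans))
    (conf (Loop Ask t) tin tcol trow (keep_shift Right torc) tout tans).
Proof. move=> h; run_step h. Qed.

Lemma ask_step t tin tcol trow torc tout tans :
  config_eq (step O (conf (Loop Ask t) tin tcol trow torc tout tans))
    (conf (Loop Copy t) tin tcol trow (tape_of (O (word_of torc))) tout tans).
Proof.
by rewrite /step /=; split=> //= i; rewrite !ffunE; case: i => [|||||u].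
Qed.

Definition set_ans (tans : T -> tape) (t : T) (a : tape) : T -> tape :=
  fun u => if u == t then a else tans u.

Lemma copy_step_some t b tin tcol trow torc tout tans a :
  read torc = Some b ->
  config_eq
    (step O (conf (Loop Copy t) tin tcol trow torc tout (set_ans tans t a)))
    (conf (Loop Copy t) tin tcol trow (shift Right (write None torc)) tout
       (set_ans tans t (shift Right (write (Some b) a)))).
Proof.
move=> h; run_step h.
by rewrite /set_ans; case: (_ == t) => //=; exact: write_read.
Qed.

Lemma copy_step_none t tin tcol trow torc tout tans a :
  read torc = None ->
  config_eq
    (step O (conf (Loop Copy t) tin tcol trow torc tout (set_ans tans t a)))
    (conf (Loop RewindAns t) tin tcol trow torc tout
       (set_ans tans t (keep_shift Left a))).
Proof.
move=> h; run_step h.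
by rewrite /set_ans; case: (_ == t) => //=; exact: write_read.
Qed.

Lemma rewind_ans_step_some t b tin tcol trow torc tout tans a :
  read a = Some b ->
  config_eq
    (step O (conf (Loop RewindAns t) tin tcol trow torc tout (set_ans tans t a)))
    (conf (Loop RewindAns t) tin tcol trow torc tout
       (set_ans tans t (keep_shift Left a))).
Proof.
move=> h; have h' : read (set_ans tans t a t) = Some b by rewrite /set_ans eqxx.
run_step h'.
by rewrite /set_ans; case: (_ == t) => //=; exact: write_read.
Qed.

Lemma rewind_ans_step_none t tin tcol trow torc tout tans a :
  read a = None ->
  config_eq
    (step O (conf (Loop RewindAns t) tin tcol trow torc tout (set_ans tans t a)))
    (conf (next_call t) tin (write (Some false) tcol) (write (Some false) trow)
       torc tout (set_ans tans t (keep_shift Right a))).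
Proof.
move=> h; have h' : read (set_ans tans t a t) = None by rewrite /set_ans eqxx.
run_step h'.
by rewrite /set_ans; case: (_ == t) => //=; exact: write_read.
Qed.

(** * Runs of the individual phases *)

Lemma scan_run n s k torc tout tans :
  reach O n.+1
    (conf Scan (nseq k (Some true), map Some (nseq n true ++ false :: s))
      (at_word [::] (nseq k true) [::]) (at_word [::] (nseq k true) [::])
      torc tout tans)
    (conf (Loop Header ord0) (at_word (nseq (n + k) (Some true)) [::] s)
      (before_word [::] (nseq (n + k) true) [::])
      (before_word [::] (nseq (n + k) true) [::]) torc tout tans).
Proof.
(* k counts the header letters already read. The erased separator becomes the blank that [at_word]
   places before s. *)
elim: n k => [|n IH] k.
  apply: reach_step (reach_refl _ _ _).
  apply: config_eq_trans (scan_step_false _ _ _ _ _ _) _ => //.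
  by apply: conf_eq => //; exact: keep_left_at.
apply: reach_step; last by rewrite addSnnS; exact: (IH k.+1).
apply: config_eq_trans (scan_step_true _ _ _ _ _ _) _ => //.
by apply: conf_eq => //; rewrite -rcons_nseq; exact: write_right_end.
Qed.

Lemma header_run t u v w tin tout tans :
  reach O (size u).+1
    (conf (Loop Header t) tin (before_word [::] u v) (before_word [::] u v)
      (at_word [::] w [::]) tout tans)
    (conf (Loop NextRow t) tin (before_word [::] [::] (u ++ v))
      (at_word [::] [::] (u ++ v))
      (at_word [::] (w ++ nseq (size u) true ++ [:: false]) [::]) tout tans).
Proof.
(* The heads move leftwards, so letters pass from the end of u to the front of v; the rewinding runs
   use the same induction. *)
elim/last_ind: u v w => [|u b IH] v w.
  apply: reach_step (reach_refl _ _ _).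
  apply: config_eq_trans (header_step_none _ _ _ _ _ _ _) _ => //.
  apply: conf_eq => //; rewrite /= cats1; exact: write_right_end.
have := IH (b :: v) (rcons w true); rewrite size_rcons !cat_rcons.
apply: reach_step.
apply: config_eq_trans (header_step_some _ _ _ _ _ _ (read_before_rcons _ _ _ _)) _.
by apply: conf_eq => //; [exact: keep_left_before.. | exact: write_right_end].
Qed.

Lemma next_row_run t u v tin trow torc tout tans :
  reach O (size u).+1
    (conf (Loop NextRow t) tin (before_word [::] u v) trow torc tout tans)
    (conf (Loop Fill t) tin (at_word [::] [::] (u ++ v)) (keep_shift Right trow)
      torc tout tans).
Proof.
elim/last_ind: u v => [|u b IH] v.
  apply: reach_step (reach_refl _ _ _).
  exact: config_eq_trans (next_row_step_none _ _ _ _ _ _ _) _.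
rewrite size_rcons cat_rcons; apply: reach_step (IH _).
apply: config_eq_trans (next_row_step_some _ _ _ _ _ _ (read_before_rcons _ _ _ _)) _.
by apply: conf_eq => //; exact: keep_left_before.
Qed.

Lemma fill_true_run t m x y l a s w trow tout tans :
  reach O m
    (conf (Loop Fill t) (at_word l a s) (at_word [::] x (nseq m true ++ y)) trow
      (at_word [::] w [::]) tout tans)
    (conf (Loop Fill t) (at_word l (a ++ take m s) (drop m s))
      (at_word [::] (x ++ nseq m true) y) trow
      (at_word [::] (w ++ take m s ++ nseq (m - size (take m s)) false) [::])
      tout tans).
Proof.
elim: m x a s w => [|m IH] x a s w.
  by rewrite take0 drop0 !cats0; exact: reach_refl.
(* With no input left, the input head stays on the blank and a 0 is written. *)
case: s => [|b s].
  have := IH (rcons x true) a [::] (rcons w false).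
  rewrite /= !subn0 !cats0 !cat_rcons; apply: reach_step.
  apply: config_eq_trans (@fill_step_false _ true _ _ _ _ _ _ _ _) _ => //.
    by right.
  by apply: conf_eq => //; [exact: keep_right_cons | exact: write_right_end].
have := IH (rcons x true) (rcons a b) s (rcons w b).
rewrite /= !subSS !cat_rcons; apply: reach_step.
apply: config_eq_trans (@fill_step_true _ b _ _ _ _ _ _ _ _) _ => //.
by apply: conf_eq => //; [exact: keep_right_cons..| exact: write_right_end].
Qed.

Lemma fill_false_run t m x w tin trow tout tans :
  reach O m
    (conf (Loop Fill t) tin (at_word [::] x (nseq m false)) trow
      (at_word [::] w [::]) tout tans)
    (conf (Loop Fill t) tin (at_word [::] (x ++ nseq m false) [::]) trow
      (at_word [::] (w ++ nseq m false) [::]) tout tans).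
Proof.
elim: m x w => [|m IH] x w; first by rewrite !cats0; exact: reach_refl.
have := IH (rcons x false) (rcons w false).
rewrite /= !cat_rcons; apply: reach_step.
apply: config_eq_trans (@fill_step_false _ false _ _ _ _ _ _ _ _) _ => //.
  by left.
by apply: conf_eq => //; [exact: keep_right_cons | exact: write_right_end].
Qed.

Lemma fill_row_run t n m l a s w trow tout tans :
  let c := nseq n true ++ nseq m false in
  reach O (n + m)
    (conf (Loop Fill t) (at_word l a s) (at_word [::] [::] c) trow
      (at_word [::] w [::]) tout tans)
    (conf (Loop Fill t) (at_word l (a ++ take n s) (drop n s))
      (at_word [::] c [::]) trow
      (at_word [::] (w ++ pad_row n m s) [::]) tout tans).
Proof.
move=> c; apply: reach_trans (fill_true_run _ _ _ _ _ _ _ _ _ _ _) _.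
by rewrite /pad_row nseqD !catA; exact: fill_false_run.
Qed.

(** j letters of [Row] are behind its head and r rows remain after the current one. A row costs n +
    m steps of filling, one step to leave [Fill], and n + m + 1 to rewind [Col]. The pair p records
    only some split of the input word at the head, since [RewindIn] follows. *)
Lemma fill_rows_run t n m r j l a s w tout tans :
  let c := nseq n true ++ nseq m false in j + r = n + m ->
  exists2 p : seq bool * seq bool, p.1 ++ p.2 = a ++ s &
  reach O (r.+1 * (n + m).+1.*2)
    (conf (Loop Fill t) (at_word l a s) (at_word [::] [::] c)
      (at_word [::] (take j c) (drop j c)) (at_word [::] w [::]) tout tans)
    (conf (Loop RewindIn t) (before_word l p.1 p.2)
      (at_word [::] c [::]) (at_word [::] c [::])
      (before_word [::] (w ++ pad_rows n m r.+1 s) [::]) tout tans).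
Proof.
move=> c; have sc : size c = n + m by rewrite size_cat !size_nseq.
elim: r j a s w => [|r IH] j a s w jr.
  exists (a ++ take n s, drop n s); first by rewrite /= -catA cat_take_drop.
  apply: (@reach_le _ _ (n + m + 1)); first by lia.
  apply: reach_trans (fill_row_run _ _ _ _ _ _ _ _ _ _) _.
  have cj : size c <= j by lia.
  rewrite (take_oversize cj) (drop_oversize cj).
  apply: reach_step (reach_refl _ _ _).
  apply: config_eq_trans (fill_step_end _ _ _ _ _ _ _) _ => //.
  by rewrite /pad_rows cats0; apply: conf_eq => //; exact: keep_left_at.
have [p pE pR] := IH j.+1 (a ++ take n s) (drop n s) (w ++ pad_row n m s) ltac:(lia).
exists p; first by rewrite pE -catA cat_take_drop.
apply: (@reach_le _ _ (n + m + (1 + ((n + m).+1 + r.+1 * (n + m).+1.*2)))).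
  by lia.
apply: reach_trans (fill_row_run _ _ _ _ _ _ _ _ _ _) _.
have jc : j < size c by lia.
rewrite (drop_nth false jc).
apply: reach_step; first exact: fill_step_row.
apply: (@reach_trans _ _ _ _ _
  (conf (Loop Fill t) (at_word l (a ++ take n s) (drop n s)) (at_word [::] [::] c)
     (at_word [::] (take j.+1 c) (drop j.+1 c))
     (at_word [::] (w ++ pad_row n m s) [::]) tout tans)); last first.
  by move: pR; rewrite -catA.
have := next_row_run t c [::] (at_word l (a ++ take n s) (drop n s))
  (at_word [::] (take j c) (nth false c j :: drop j.+1 c))
  (at_word [::] (w ++ pad_row n m s) [::]) tout tans.
rewrite cats0 sc => nr.
apply: eq_reach (reach_eq nr _); apply: conf_eq => //; first exact: keep_left_at.
by rewrite (take_nth false jc); exact: keep_right_cons.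
Qed.

Lemma rewind_in_run t u v l tcol trow torc tout tans :
  reach O (size u).+1
    (conf (Loop RewindIn t) (before_word l u v) tcol trow torc tout tans)
    (conf (Loop RewindOrc t) (at_word l [::] (u ++ v)) tcol trow torc tout tans).
Proof.
elim/last_ind: u v => [|u b IH] v.
  apply: reach_step (reach_refl _ _ _).
  exact: config_eq_trans (rewind_in_step_none _ _ _ _ _ _ _) _.
rewrite size_rcons cat_rcons; apply: reach_step (IH _).
apply: config_eq_trans (rewind_in_step_some _ _ _ _ _ _ (read_before_rcons _ _ _ _)) _.
by apply: conf_eq => //; exact: keep_left_before.
Qed.

Lemma rewind_orc_run t u v tin tcol trow tout tans :
  reach O (size u).+1
    (conf (Loop RewindOrc t) tin tcol trow (before_word [::] u v) tout tans)
    (conf (Loop Ask t) tin tcol trow (at_word [::] [::] (u ++ v)) tout tans).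
Proof.
elim/last_ind: u v => [|u b IH] v.
  apply: reach_step (reach_refl _ _ _).
  exact: config_eq_trans (rewind_orc_step_none _ _ _ _ _ _ _) _.
rewrite size_rcons cat_rcons; apply: reach_step (IH _).
apply: config_eq_trans (rewind_orc_step_some _ _ _ _ _ _ (read_before_rcons _ _ _ _)) _.
by apply: conf_eq => //; exact: keep_left_before.
Qed.

Lemma set_ans_eq tans t a a' u :
  tape_eq a a' -> tape_eq (set_ans tans t a u) (set_ans tans t a' u).
Proof. by rewrite /set_ans; case: ifP. Qed.

(** Letters are erased as they are copied, leaving k blanks behind the head; the oracle tape thus
    ends up empty up to trailing blanks, ready for the next query. *)
Lemma copy_run t a k w tin tcol trow tout tans :
  reach O (size a).+1
    (conf (Loop Copy t) tin tcol trow (nseq k None, map Some a) tout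
      (set_ans tans t (at_word [::] w [::])))
    (conf (Loop RewindAns t) tin tcol trow (at_word [::] [::] [::]) tout
      (set_ans tans t (before_word [::] (w ++ a) [::]))).
Proof.
elim: a k w => [|b a IH] k w.
  apply: reach_step (reach_refl _ _ _).
  apply: config_eq_trans (copy_step_none _ _ _ _ _ _ _ _) _ => //.
  apply: conf_eq => //.
    by split=> // i; rewrite nth_nseq; case: ifP; case: i => [|[]].
  by move=> u; rewrite cats0; apply: set_ans_eq; exact: keep_left_at.
have := IH k.+1 (rcons w b); rewrite cat_rcons; apply: reach_step.
apply: config_eq_trans (@copy_step_some _ b _ _ _ _ _ _ _ _) _ => //.
by apply: conf_eq => // u; apply: set_ans_eq; exact: write_right_end.
Qed.

Lemma rewind_ans_run t u v tin tcol trow torc tout tans :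
  reach O (size u).+1
    (conf (Loop RewindAns t) tin tcol trow torc tout
      (set_ans tans t (before_word [::] u v)))
    (conf (next_call t) tin (write (Some false) tcol) (write (Some false) trow)
      torc tout (set_ans tans t (at_word [::] [::] (u ++ v)))).
Proof.
elim/last_ind: u v => [|u b IH] v.
  apply: reach_step (reach_refl _ _ _).
  apply: config_eq_trans (rewind_ans_step_none _ _ _ _ _ _ _ (read_before_nil _ _)) _.
  by apply: conf_eq => // x; exact: set_ans_eq.
rewrite size_rcons cat_rcons; apply: reach_step (IH _).
apply: config_eq_trans
  (rewind_ans_step_some _ _ _ _ _ _ _ (read_before_rcons _ _ _ _)) _.
by apply: conf_eq => // x; apply: set_ans_eq; exact: keep_left_before.
Qed.

(** * One oracle call, and the sequence of all calls *)

Lemma call_run t n m l s tout tans :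
  let N := n + m in
  let c := nseq n true ++ nseq m false in
  let a := O (nseq N true ++ false :: pad_rows n m N s) in
  reach O (10 * N.+1 ^ 2 + size s + (size a).*2)
    (conf (Loop Header t) (at_word l [::] s) (before_word [::] c [::])
      (before_word [::] c [::]) (at_word [::] [::] [::]) tout
      (set_ans tans t (at_word [::] [::] [::])))
    (conf (next_call t) (at_word l [::] s) (before_word [::] (rcons c false) [::])
      (before_word [::] (rcons c false) [::]) (at_word [::] [::] [::]) tout
      (set_ans tans t (at_word [::] [::] a))).
Proof.
move=> N c a; have sc : size c = N by rewrite size_cat !size_nseq.
set w := nseq N true ++ [:: false].
set ans0 := set_ans tans t _.
(* The head of [Row] has moved right once before the first row is filled. If N = 0 there is no
   letter to pass, and the single row that gets filled is empty. *)
pose j := (0 < N : nat).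
have [p pE fillR] : exists2 p : seq bool * seq bool, p.1 ++ p.2 = s &
    reach O (N.+1 * N.+1.*2)
    (conf (Loop Fill t) (at_word l [::] s) (at_word [::] [::] c)
      (at_word [::] (take j c) (drop j c)) (at_word [::] w [::]) tout ans0)
    (conf (Loop RewindIn t) (before_word l p.1 p.2)
      (at_word [::] c [::]) (at_word [::] c [::])
      (before_word [::] (w ++ pad_rows n m N s) [::]) tout ans0).
  have jN : j + N.-1 = n + m by rewrite /j -/N; case: (N).
  have [p pE pR] := fill_rows_run t l [::] s w tout ans0 jN; exists p => //.
  have <- : pad_rows n m N.-1.+1 s = pad_rows n m N s.
    have [/eqP|/prednK -> //] := posnP N; rewrite addn_eq0 => /andP[/eqP n0 /eqP m0].
    by rewrite /N n0 m0 /= /pad_row take0.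
  by apply: reach_le pR; apply: leq_mul => //; case: (N).
have sp : size p.1 <= size s by rewrite -pE size_cat leq_addr.
(* The summands are the times of [Header], the first [NextRow], all rows, [RewindIn], [RewindOrc],
   [Ask], [Copy] and [RewindAns]. *)
apply: (@reach_le _ _ (N.+1 + (1 + (N.+1 * N.+1.*2 + ((size s).+1 + ((N.+1 + N * N).+1
   + (1 + ((size a).+1 + (size a).+1)))))))); first by lia.
have headR := header_run t c [::] [::] (at_word l [::] s) tout ans0.
rewrite sc !cats0 in headR; apply: reach_trans headR _.
have nextR := next_row_run t [::] c (at_word l [::] s) (at_word [::] [::] c)
  (at_word [::] w [::]) tout ans0.
apply: reach_trans nextR _.
have rowE : tape_eq (keep_shift Right (at_word [::] [::] c))
                    (at_word [::] (take j c) (drop j c)).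
  rewrite /j -sc; case: (c) => [|b c'] /=.
    by split=> -[|[|k]] //=; rewrite nth_nil.
  by rewrite take0 drop0; exact: keep_right_cons.
have startE : config_eq
    (conf (Loop Fill t) (at_word l [::] s) (at_word [::] [::] ([::] ++ c))
      (keep_shift Right (at_word [::] [::] c)) (at_word [::] w [::]) tout ans0)
    (conf (Loop Fill t) (at_word l [::] s) (at_word [::] [::] c)
      (at_word [::] (take j c) (drop j c)) (at_word [::] w [::]) tout ans0).
  exact: conf_eq.
apply: reach_trans (eq_reach startE fillR) _.
have inR := rewind_in_run t p.1 p.2 l (at_word [::] c [::]) (at_word [::] c [::])
  (before_word [::] (w ++ pad_rows n m N s) [::]) tout ans0.
rewrite pE in inR; apply: reach_trans (reach_le _ inR) _ => //.
have orcR := rewind_orc_run t (w ++ pad_rows n m N s) [::] (at_word l [::] s)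
  (at_word [::] c [::]) (at_word [::] c [::]) tout ans0.
rewrite cats0 size_cat size_pad_rows size_cat size_nseq /= addn1 in orcR.
apply: reach_trans orcR _.
apply: reach_step; first exact: ask_step.
have -> : word_of (at_word [::] [::] (w ++ pad_rows n m N s)) =
          nseq N true ++ false :: pad_rows n m N s.
  by rewrite -[_ ++ false :: _]cat_rcons -cats1 /word_of /=; elim: (_ ++ _) => //= b x ->.
rewrite -/a.
apply: reach_trans (copy_run t a 0 [::] _ _ _ _ _) _.
apply: reach_eq (rewind_ans_run t a [::] _ _ _ _ _ _) _.
rewrite !cats0; apply: conf_eq => //; by rewrite before_word_rcons.
Qed.

(** Induction on the number q - t of calls still to come after call t: before it, the counters hold
    1^n 0^t and the answers of smaller index are on their tapes. *)
Lemma calls_run n s A l tout (ans : T -> seq bool) :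
  (forall t : T,
     O (nseq (n + t) true ++ false :: pad_rows n t (n + t) s) = ans t) ->
  (forall t, size (ans t) <= A) ->
  forall t : T, exists tcol trow,
  reach O ((q - t).+1 * (10 * (n + q).+1 ^ 2 + size s + A.*2))
    (conf (Loop Header t) (at_word l [::] s)
      (before_word [::] (nseq n true ++ nseq t false) [::])
      (before_word [::] (nseq n true ++ nseq t false) [::])
      (at_word [::] [::] [::]) tout
      (fun u => at_word [::] [::] (if u < t then ans u else [::])))
    (conf (Add (inord coef_bound)) (at_word l [::] s) tcol trow
      (at_word [::] [::] [::]) tout (fun u => at_word [::] [::] (ans u))).
Proof.
move=> ansE ansA t; have [d] := ubnP (q - t); elim: d t => // d IH t dt.
set tans := fun u : T => _.
have tq : t <= q by rewrite -ltnS.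
have := @call_run t n t l s tout tans; cbv zeta; rewrite ansE => callR.
have {}callR : reach O (10 * (n + q).+1 ^ 2 + size s + A.*2)
    (conf (Loop Header t) (at_word l [::] s)
      (before_word [::] (nseq n true ++ nseq t false) [::])
      (before_word [::] (nseq n true ++ nseq t false) [::])
      (at_word [::] [::] [::]) tout tans)
    (conf (next_call t) (at_word l [::] s)
      (before_word [::] (nseq n true ++ nseq t.+1 false) [::])
      (before_word [::] (nseq n true ++ nseq t.+1 false) [::])
      (at_word [::] [::] [::]) tout
      (fun u => at_word [::] [::] (if u < t.+1 then ans u else [::]))).
  rewrite -rcons_nseq -rcons_cat.
  apply: eq_reach; last first.
    apply: reach_eq (reach_le _ callR) _.
      by rewrite !leq_add ?leq_mul ?leq_exp2r ?leq_double ?ansA // ltnS leq_add2l.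
    apply: conf_eq => // u; rewrite /set_ans /tans ltnS (leq_eqVlt u t).
    by rewrite -val_eqE /=; case: eqP => // /ord_inj ->.
  apply: conf_eq => // u; rewrite /set_ans /tans.
  by case: eqP => // ->; rewrite ltnn.
have [lt_tq|ge_tq] := ltnP t q.
  have tE : (inord t.+1 : T) = t.+1 :> nat by rewrite inordK.
  have [|tcol [trow IHR]] := IH (inord t.+1); first by rewrite tE; lia.
  exists tcol, trow; rewrite tE in IHR.
  have -> : q - t = (q - t.+1).+1 by lia.
  rewrite mulSn; apply: reach_trans callR _.
  by rewrite /next_call lt_tq.
have tE : nat_of_ord t = q by lia.
do 2!eexists; apply: (@reach_le _ _ (10 * (n + q).+1 ^ 2 + size s + A.*2)).
  by rewrite leq_pmull.
rewrite /next_call ltnNge ge_tq /= in callR.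
apply: reach_eq callR _; apply: conf_eq => // u.
by rewrite tE ltn_ord.
Qed.

(** * Weighted addition with a signed carry *)

Lemma add_step_end (e : E) tin tcol trow torc tout tans :
  (forall t, read (tans t) = None) -> e = coef_bound :> nat ->
  config_eq (step O (conf (Add e) tin tcol trow torc tout tans))
    (conf (Div ord0 false) tin tcol trow torc (keep_shift Left tout) tans).
Proof.
move=> tn eB; rewrite /step /= /add_step eB eqxx andbT.
have -> : [forall t, [ffun i => read ((conf (Add e) tin tcol trow torc tout tans).(tapes) i)]
            (Ans t) == None].
  by apply/forallP => t; rewrite !ffunE /= tn.
split=> //=; case=> [|||||u]; rewrite !ffunE /= ?ffunE //=; exact: write_read.
Qed.

Lemma add_step_bit (e : E) tin tcol trow torc tout tans :
  ~~ ([forall t, read (tans t) == None] && (e == coef_bound :> nat)) ->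
  let m := e + \sum_t weight t (odflt false (read (tans t))) in
  config_eq (step O (conf (Add e) tin tcol trow torc tout tans))
    (conf (Add (inord m./2)) tin tcol trow torc
      (shift Right (write (Some (odd m)) tout)) (fun t => keep_shift Right (tans t))).
Proof.
move=> go m; rewrite /step /= /add_step.
set v := [ffun i => _].
have vE t : v (Ans t) = read (tans t) by rewrite !ffunE.
have -> : [forall t, v (Ans t) == None] = [forall t, read (tans t) == None].
  by apply: eq_forallb => t; rewrite vE.
have -> : \sum_t weight t (odflt false (v (Ans t))) =
          \sum_t weight t (odflt false (read (tans t))).
  by apply: eq_bigr => t _; rewrite vE.
rewrite (negPf go) -/m.
split=> //=; case=> [|||||u]; rewrite !ffunE /= ?ffunE //=; exact: write_read.
Qed.

Lemma weightE t b : ((weight t b)%:Z = (absz (coef t))%:Z + coef t * b%:R)%R.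
Proof. rewrite /weight; case: b => /=; lia. Qed.

(** Together with the same bound on e, this keeps the next carry within its finite range. *)
Lemma weight_sum_le (b : T -> bool) : \sum_t weight t (b t) <= coef_bound.*2.
Proof.
rewrite -mul2n /coef_bound big_distrr /=; apply: leq_sum => t _.
by rewrite /weight; case: (b t) => /=; lia.
Qed.

Lemma weight_sumE (b : T -> bool) :
  (((\sum_t weight t (b t))%N)%:Z = coef_bound%:Z + \sum_t coef t * (b t)%:R)%R.
Proof.
rewrite /coef_bound -!natz !natr_sum -big_split /=.
by apply: eq_bigr => t _; rewrite !natz weightE natz.
Qed.

(** Y is the number still to be written, and the equation is the loop invariant. After k steps Y and
    the answers are used up, so the equation forces the carry 0 and the loop stops. Cancellation may
    leave leading zeros in u, which the division removes. *)
Lemma add_run k (e : E) (Y : nat) (a : T -> seq bool) lf w tin tcol trow torc :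
  (forall t, size (a t) <= k) -> Y < 2 ^ k ->
  (Y%:Z + coef_bound%:Z = e%:Z + \sum_t coef t * (num_of_bits (a t))%:R)%R ->
  exists u tans, [/\ num_of_bits u = Y, size u <= k &
  reach O k.+1
    (conf (Add e) tin tcol trow torc (at_word [::] w [::])
       (fun t => (lf t, map Some (a t))))
    (conf (Div ord0 false) tin tcol trow torc (before_word [::] (w ++ u) [::]) tans)].
Proof.
elim: k e Y a lf w => [|k IH] e Y a lf w sa Yk YE;
  set tans := (fun t : T => _ : tape).
  have a0 t : a t = [::] by apply/nilP; rewrite /nilp -leqn0.
  have Y0 : Y = 0 by move: Yk; rewrite expn0; case: (Y).
  have eB : e = coef_bound :> nat.
    move: YE; rewrite Y0 big1 => [|t _]; last by rewrite a0 mulr0.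
    by lia.
  exists [::], tans; split=> //.
  apply: reach_step (reach_refl _ _ _); rewrite cats0.
  apply: config_eq_trans.
    by apply: add_step_end eB => t; rewrite /tans a0.
  by apply: conf_eq => //; exact: keep_left_at.
have rE t : read (tans t) = ohead (a t) by rewrite /tans; case: (a t).
have [/andP[/forallP an /eqP eB]|go] :=
    boolP ([forall t, read (tans t) == None] && (e == coef_bound :> nat)).
  have a0 t : a t = [::] by move: (an t); rewrite rE; case: (a t).
  exists [::], tans; split => //.
    move: YE; rewrite eB big1 => [|t _]; last by rewrite a0 mulr0.
    by rewrite /=; lia.
  apply: reach_step; last by rewrite cats0; exact: reach_refl.
  apply: config_eq_trans.
    by apply: add_step_end eB => t; rewrite /tans a0.
  by apply: conf_eq => //; exact: keep_left_at.
set m := e + \sum_t weight t (odflt false (read (tans t))).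
have eB := ltn_ord e; rewrite ltnS in eB.
have mB : m./2 < coef_bound.*2.+1.
  by have := weight_sum_le (fun t => odflt false (read (tans t))); rewrite /m; lia.
pose S := (\sum_t coef t * (num_of_bits (behead (a t)))%:R)%R.
have SE : (\sum_t coef t * (num_of_bits (a t))%:R =
    \sum_t coef t * (odflt false (read (tans t)))%:R + S *+ 2)%R.
  rewrite /S -sumrMnl -big_split /=; apply: eq_bigr => t _.
  rewrite rE num_of_bits_head -mulrnAr -mulrDr natrD -muln2 natrM mulr_natr.
  by case: (a t).
(* The shifts of the carry and of the weights add up to twice [coef_bound]. Hence m has the parity
   of Y, and halving restores the invariant with the carry [m./2]. *)
have YE' : (Y%:Z + coef_bound%:Z *+ 2 = m%:Z + S *+ 2)%R.
  have := weight_sumE (fun t => odflt false (read (tans t))).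
  by move: YE; rewrite SE /m; lia.
have [|||u [tans' [uY su uR]]] := IH (inord m./2) Y./2 (fun t => behead (a t))
   (fun t => ohead (a t) :: lf t) (rcons w (odd m)).
- by move=> t; rewrite size_behead; have := sa t; lia.
- by move: Yk; rewrite expnS; lia.
- by rewrite inordK // -/S; lia.
exists (odd m :: u), tans'; split=> //=.
  have -> : odd m = odd Y by move: YE'; clearbody m S; lia.
  by rewrite -[RHS]odd_double_half -uY.
rewrite -cat_rcons; apply: reach_step uR.
apply: config_eq_trans; first exact: add_step_bit go.
apply: conf_eq => //; first exact: write_right_end.
by move=> t; rewrite /tans; case: (a t).
Qed.

(** * Long division in place *)

Lemma div_step_bit (r : 'I_den.+1) f b tin tcol trow torc tout tans :
  read tout = Some b ->
  let m := b + r.*2 in let f' := f || (den <= m) in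
  config_eq (step O (conf (Div r f) tin tcol trow torc tout tans))
    (conf (Div (inord (m %% den)) f') tin tcol trow torc
      (shift Left (write (if f' then Some (den <= m) else None) tout)) tans).
Proof. move=> h m f'; rewrite /step /= /div_step; run_step h. Qed.

Lemma div_step_end (r : 'I_den.+1) f tin tcol trow torc tout tans :
  read tout = None ->
  config_eq (step O (conf (Div r f) tin tcol trow torc tout tans))
    (conf Done tin tcol trow torc (keep_shift Right tout) tans).
Proof. move=> h; rewrite /step /= /div_step; run_step h. Qed.

(** h is the value of the leading bits already processed: its remainder is in the control state, its
    quotient stands on the tape to the right of the head, and the lower bits u are still to be read
    from right to left. *)
Lemma div_run (h : nat) u tin tcol trow torc tans :
  0 < den ->
  reach O (size u).+1
    (conf (Div (inord (h %% den)) (h %/ den != 0)) tin tcol trow torc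
      (before_word [::] u (binary (h %/ den))) tans)
    (conf Done tin tcol trow torc
      (at_word [::] [::] (binary ((num_of_bits u + h * 2 ^ size u) %/ den))) tans).
Proof.
move=> den0; elim/last_ind: u h => [|u b IH] h.
  rewrite /= expn0 muln1; apply: reach_step (reach_refl _ _ _).
  exact: config_eq_trans (div_step_end _ _ _ _ _ _ _ (read_before_nil _ _)) _.
rewrite size_rcons num_of_bits_rcons.
have -> : num_of_bits u + b * 2 ^ size u + h * 2 ^ (size u).+1 =
          num_of_bits u + (b + h.*2) * 2 ^ size u by rewrite expnS; lia.
apply: reach_step (IH _).
apply: config_eq_trans (div_step_bit _ _ _ _ _ _ _ (read_before_rcons _ _ _ _)) _.
set r : 'I_den.+1 := inord (h %% den); set z := h %/ den.
have rlt : h %% den < den by rewrite ltn_pmod.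
have rE : r = h %% den :> nat by rewrite inordK // ltnW.
set m := b + r.*2; set d := den <= m.
(* The old remainder is below [den], so the next quotient digit is a single bit. *)
have m2 : m < den * 2 by rewrite /m rE; case: (b); lia.
have mE : m = d * den + m %% den.
  rewrite {1}(divn_eq m den); congr (_ * _ + _); rewrite /d.
  case: leqP => md; last by rewrite divn_small.
  by apply/eqP; rewrite eqn_leq -ltnS ltn_divLR // mulnC m2 divn_gt0.
have hE : b + h.*2 = (d + z.*2) * den + m %% den.
  rewrite mulnDl addnAC -mE /m rE {1}(divn_eq h den) -/z -!muln2; lia.
have mlt : m %% den < den by rewrite ltn_pmod.
have -> : (b + h.*2) %% den = m %% den by rewrite hE modnMDl modn_small.
have -> : (b + h.*2) %/ den = d + z.*2.
  by rewrite hE divnMDl // (divn_small mlt) addn0.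
have -> : (d + z.*2 != 0) = (z != 0) || d by case: (d); lia.
apply: conf_eq => //; rewrite before_word_rcons binary_cons.
(* While the quotient is 0 a blank is written, in accordance with the empty numeral of 0. *)
case: (altP (d + z.*2 =P 0)) => [dz|].
  have [-> ->] : z = 0 /\ d = false by case: (d) dz; lia.
  by split=> //= -[|[|k]] //=; rewrite nth_nil.
by move=> dz; have -> : (z != 0) || d by case: (d) dz; lia.
Qed.

(** The time is n + 1 for the scan, then q + 1 calls, then A + 1 each for the addition and the
    division, where A bounds all lengths of numerals. *)
Lemma combine_computes n s A Y (ans : T -> seq bool) :
  0 < den ->
  (forall t : T,
     O (nseq (n + t) true ++ false :: pad_rows n t (n + t) s) = ans t) ->
  (forall t, size (ans t) <= A) -> Y < 2 ^ A ->
  (Y%:Z = \sum_t coef t * (num_of_bits (ans t))%:R)%R ->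
  computes_within combine_machine O
    (n.+1 + (q.+1 * (10 * (n + q).+1 ^ 2 + size s + A.*2) + (A.+1 + A.+1)))
    (nseq n true ++ false :: s) (binary (Y %/ den)).
Proof.
move=> den0 ansE ansA YA YE.
set blank := at_word [::] [::] [::].
have [tcol [trow callsR]] :=
  @calls_run n s A (nseq n (Some true)) blank ans ansE ansA ord0.
have BE : (inord coef_bound : E) = coef_bound :> nat by rewrite inordK //; lia.
have [||| u [tans [uY uA addR]]] := @add_run A (inord coef_bound) Y ans
  (fun=> [:: None]) [::] (at_word (nseq n (Some true)) [::] s) tcol trow blank.
- by [].
- by [].
- by rewrite BE YE addrC.
have divR := @div_run 0 u (at_word (nseq n (Some true)) [::] s) tcol trow blank tans den0.
rewrite mul0n addn0 uY mod0n div0n eqxx /= in divR.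
have := @reach_computes combine_machine O _ (nseq n true ++ false :: s) _ _.
move/(_ _ (conf Done (at_word (nseq n (Some true)) [::] s) tcol trow blank
   (at_word [::] [::] (binary (Y %/ den))) tans)).
have -> : output (conf Done (at_word (nseq n (Some true)) [::] s) tcol trow blank
   (at_word [::] [::] (binary (Y %/ den))) tans) = binary (Y %/ den).
  by rewrite /output ffunE /word_of /=; elim: (binary _) => //= b x ->.
apply=> //; rewrite subn0 in callsR.
have scanR := scan_run n s 0 blank blank (fun=> blank); rewrite addn0 in scanR.
apply: (eq_reach _ (reach_trans scanR _)).
  split=> //= i; rewrite !ffunE.
  case: i => [|||||t] //=; exact: tape_of_at_word.
apply: reach_trans.
  apply: eq_reach callsR; rewrite cats0; exact: conf_eq.
apply: reach_trans; first exact: addR.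
rewrite (_ : (ord0 : 'I_den.+1) = inord 0); last by apply: val_inj; rewrite /= inordK.
exact: reach_le divR.
Qed.

End Machine.

(** * The reduction *)

Lemma size_entries (G : irrefl_graph) : size (entries G) = num_vertices G ^ 2.
Proof. by rewrite size_allpairs size_enum_ord -mulnn. Qed.

Lemma num_hom_le (G : irrefl_graph) (H : graph) :
  num_hom G H <= #|H| ^ num_vertices G.
Proof. by apply: leq_trans (max_card _) _; rewrite card_ffun card_ord. Qed.

Lemma num_shom_le (G : irrefl_graph) (H : graph) : num_shom G H <= num_hom G H.
Proof. by apply/subset_leq_card/subsetP => h; rewrite !inE => /andP[]. Qed.

Lemma leq_exp_base (m n e : nat) : m <= n -> m ^ e <= n ^ e.
Proof. by case: e => // e mn; rewrite leq_exp2r. Qed.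

Lemma fact_le_exp (k m : nat) : k <= m -> k`! <= m ^ k.
Proof.
elim: k => // k IH km; rewrite factS expnS leq_mul //.
by apply: IH; exact: ltnW.
Qed.

(** With c = (q + 1)^2 and X = (L + 1)^2, both (n + q + 1)^2 and A are at most c X. A call thus
    costs at most (12 c + 1) X, the last two passes at most 4 c X and the scan at most X. *)
Lemma reduction_time_le (q n s L A : nat) :
  n <= L -> s <= L -> A = (q * (n + q)).+1 ->
  n.+1 + (q.+1 * (10 * (n + q).+1 ^ 2 + s + A.*2) + (A.+1 + A.+1)) <=
  (q.+1 * (12 * q.+1 ^ 2 + 1) + 4 * q.+1 ^ 2 + 1) * L.+1 ^ 2.
Proof.
move=> nL sL AE; set X := L.+1 ^ 2; set c := q.+1 ^ 2.
have LX : L.+1 <= X by rewrite /X expnS expn1 leq_pmulr.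
have c0 : 0 < c by rewrite expn_gt0.
have sqX : (n + q).+1 ^ 2 <= c * X by rewrite -expnMn leq_exp2r //; nia.
have AX : A.+1 <= (c * X).*2.
  by apply: (@leq_trans (c * L.+1).*2); rewrite ?leq_double ?leq_mul // AE /c; nia.
have AX' : A <= c * X.
  by apply: (@leq_trans (c * L.+1)); rewrite ?leq_mul // AE /c; nia.
rewrite !mulnDl mul1n -mulnA addnC -!addnA; apply: leq_add; last by nia.
by rewrite leq_mul // mulnDl; nia.
Qed.

Theorem theorem4p3 (H : graph) :
  poly_turing_reducible (count_hom H) (count_shom H).
Proof.
set q := #|H|.
set c := q.+1 * (12 * q.+1 ^ 2 + 1) + 4 * q.+1 ^ 2 + 1.
(* The weights and the divisor depend on H alone, so they can be built into the machine. *)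
exists (combine_machine (fun t : 'I_q.+1 => (falling_poly q)`_t)%R q`!).
exists (c%:P * ('X + 1%:P) ^+ 2)%R => O oracle G; set n := num_vertices G.
have -> : ((c%:P * ('X + 1%:P) ^+ 2).[size (encode (G : instance (count_hom H)))])%R =
          c * (size (encode_graph G)).+1 ^ 2.
  rewrite hornerM horner_exp hornerD hornerX !hornerC -[encode _]/(encode_graph G).
  by rewrite natrXE natrDE addn1.
have sizeE : size (encode_graph G) = n + (n ^ 2).+1.
  by rewrite size_cat size_nseq /= -size_entries.
(* Since q < 2^q, the answers, at most q^(n + q), and the total q! hom(G, H), at most q^q q^n, are
   all below 2^A. *)
set A := (q * (n + q)).+1.
have boundA (t : 'I_q.+1) : num_shom (pad G t) H < 2 ^ A.
  apply: (@leq_ltn_trans ((2 ^ q) ^ (n + q))); last by rewrite -expnM ltn_exp2l.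
  apply: leq_trans (leq_trans (num_shom_le _ _) (num_hom_le _ _)) _.
  apply: (@leq_trans ((2 ^ q) ^ (n + t))).
    by rewrite leq_exp_base // ltnW // ltn_expl.
  by rewrite leq_pexp2l ?expn_gt0 // leq_add2l -ltnS.
have homA : q`! * num_hom G H < 2 ^ A.
  apply: (@leq_ltn_trans ((2 ^ q) ^ (n + q))); last by rewrite -expnM ltn_exp2l.
  rewrite addnC expnD leq_mul //.
    by apply: leq_trans (fact_le_exp (leqnn q)) _; rewrite leq_exp_base // ltnW // ltn_expl.
  by apply: leq_trans (num_hom_le _ _) _; rewrite leq_exp_base // ltnW // ltn_expl.
have := @combine_computes q (fun t : 'I_q.+1 => (falling_poly q)`_t)%R q`! O
  n (entries G) A (q`! * num_hom G H) (fun t => binary (num_shom (pad G t) H)).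
rewrite mulKn ?fact_gt0 // => combR.
apply: computes_within_le (combR _ _ _ _ _) => //.
- by rewrite /c; apply: reduction_time_le => //; rewrite sizeE ?size_entries; lia.
- by move=> t; rewrite -(oracle (pad G t)) /= encode_pad.
- by move=> t; exact: size_binary_le.
- rewrite -natz -num_hom_from_shom; apply: eq_bigr => t _.
  by rewrite num_of_binary.
Qed.
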